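(* For all real numbers $L,L'\in[0,2/\pi]$ with $L\le L'$, there exists $w\in\{0,1\}^{\omega}$ such that \[ \liminf_{n\to\infty}\left(\frac{d_n(w)}{n!}\right)^{1/n}=L\quad\text{and}\quad\limsup_{n\to\infty}\left(\frac{d_n(w)}{n!}\right)^{1/n}=L'. \]
   Context: $\{0,1\}^{\omega}$ is the set of infinite binary words $w=w_1w_2\cdots$, $w[k]=w_1\cdots w_k$. For $\pi\in\mathfrak{S}_n$, $\mathrm{Des}(\pi)=x_1\cdots x_{n-1}$ with $x_i=1$ iff $\pi_i>\pi_{i+1}$, and $d_n(w)$ is the number of $\pi\in\mathfrak{S}_n$ with $\mathrm{Des}(\pi)=w[n-1]$. *)

(* Defs.v *)
From mathcomp Require Import all_boot all_order all_algebra all_fingroup.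
From mathcomp Require Import all_classical all_reals all_analysis.

Set Implicit Arguments.
Unset Strict Implicit.
Unset Printing Implicit Defensive.

Import Order.TTheory GRing.Theory Num.Theory.

(* Infinite binary words; letters are indexed from 0, so [w i] is the letter
   w_{i+1}, and [true] is the letter 1. *)
Definition infword := nat -> bool.

(* w[k] = w_1 ... w_k *)
Definition wprefix (w : infword) (k : nat) : seq bool := mkseq w k.

(* One-line notation pi_1 ... pi_n, with values shifted to {0, ..., n-1}. *)
Definition one_line (n : nat) (s : 'S_n) : seq nat :=
  [seq nat_of_ord (s i) | i <- enum 'I_n].

Definition Des (n : nat) (s : 'S_n) : seq bool :=
  mkseq (fun i => nth 0 (one_line s) i.+1 < nth 0 (one_line s) i) n.-1.

Definition d_ (n : nat) (w : infword) : nat :=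
  #|[set s : 'S_n | Des s == wprefix w n.-1]|.

Local Open Scope ring_scope.

(* (d_n(w) / n!)^(1/n); the value at n = 0 is irrelevant to the limits. *)
Definition dratio_root (R : realType) (w : infword) (n : nat) : R :=
  ((d_ n w)%:R / (n`!)%:R) `^ (n%:R^-1).

(* Main.v *)
Require Import Defs.
From mathcomp Require Import all_boot all_order all_algebra all_fingroup.
From mathcomp Require Import all_classical all_reals all_analysis.
From mathcomp Require Import zify ring lra.

Set Implicit Arguments.
Unset Strict Implicit.
Unset Printing Implicit Defensive.

Import Order.TTheory GRing.Theory Num.Theory.
Import numFieldNormedType.Exports.
Local Open Scope ring_scope.

(** Write [p_n = d_n(w) / n!] and [a_n = p_n^(1/n)].  Counting permutations by
    their last value shows [p_n / (n+1) <= p_(n+1) <= p_n] for either choice of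
    the next letter, so [a_(n+1) - a_n -> 0] uniformly in [w].  A prefix can be
    continued so as to pull [a_n] down or up.  Appending [k] ascents gives
    [p_(n+k) <= p_n / k!], so [a] tends to 0 and, by AM-GM, never rises by more
    than [O(1/n)] on the way.  For the other direction let [f_n] be the density
    of the last of [n] uniform variables on the event that they realise the
    pattern; then [f_(n+1)' = f_n] after an ascent and [- f_n] after a descent,
    and integrating by parts against [sin (pi x / 2)] and [cos (pi x / 2)] shows
    that an alternating continuation multiplies one of these two moments by
    exactly [2 / pi] at each step.  As the moments add up to at least [p_n], this
    gives [p_(n+k) >= (2 / pi)^k p_n / 2], so [a] tends to at least [2 / pi] and
    never drops by more than [O(1/n)] below [min (a_n, 2 / pi)].  Alternating
    between climbing to [L'] and descending to [L], with errors tending to 0,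
    yields the word. *)

(** * Counting by the last value *)

Section last_value.
Local Open Scope nat_scope.

(* The number of permutations in S_(n+1) (not S_n) with descent word w[n] and
   last value j, for j <= n; outside this range the value is junk. *)
Fixpoint dlast (w : infword) (n j : nat) : nat :=
  if n is m.+1 then
    if w m then \sum_(j <= i < m.+1) dlast w m i
    else \sum_(0 <= i < j) dlast w m i
  else (j == 0).

Lemma nth_one_line n (s : 'S_n) (i : 'I_n) : nth 0 (one_line s) i = s i.
Proof.
rewrite /one_line (nth_map i) ?size_enum_ord ?ltn_ord //.
by rewrite nth_ord_enum.
Qed.

Lemma Des_eqP n (s : 'S_n) (w : infword) :
  reflect (forall i : nat, i.+1 < n ->
     (nth 0 (one_line s) i.+1 < nth 0 (one_line s) i) = w i)
    (Des s == wprefix w n.-1).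
Proof.
apply: (iffP eqP) => [eqD i lt_in|eqD].
  have lt_in' : i < n.-1 by lia.
  by have := congr1 (fun v => nth false v i) eqD; rewrite !nth_mkseq.
by apply/eq_in_map => i; rewrite mem_iota => /= lt_in; apply: eqD; lia.
Qed.

Definition dcount n (w : infword) (j : nat) :=
  #|[set s : 'S_n.+1 | (Des s == wprefix w n) && (s ord_max == j :> nat)]|.

Lemma lift_perm_inj n (i j : 'I_n.+1) : injective (@lift_perm n i j).
Proof.
move=> s t eq_st; apply/permP => k.
by apply: (@lift_inj _ j); rewrite -!(lift_perm_lift i) eq_st.
Qed.

(** Since [t] maps the complement of [i] onto the complement of [j], relabelling both through [lift]
    produces [s]. With injectivity this makes deletion of the last entry a bijection. *)
Lemma lift_perm_surj n (i j : 'I_n.+1) (t : 'S_n.+1) :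
  t i = j -> exists s, t = lift_perm i j s.
Proof.
move=> tij.
have tlift k : t (lift i k) != j by rewrite -tij (inj_eq perm_inj) eq_sym neq_lift.
have /fin_all_exists [f fP] k : exists k', t (lift i k) = lift j k'.
  by case: (unliftP j (t (lift i k))) (tlift k) => [k' -> _|->]; [exists k'|rewrite eqxx].
have f_inj : injective f.
  move=> k k' eqf; apply: (@lift_inj _ i); apply: (@perm_inj _ t).
  by rewrite !fP eqf.
exists (perm f_inj); apply/permP => k.
case: (unliftP i k) => [k'|] ->; last by rewrite lift_perm_id.
by rewrite lift_perm_lift permE fP.
Qed.

Lemma nth_lift_perm n (j : 'I_n.+2) (s : 'S_n.+1) (i : nat) : i < n.+1 ->
  nth 0 (one_line (lift_perm ord_max j s)) i = bump j (nth 0 (one_line s) i).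
Proof.
move=> lt_in; have -> : i = Ordinal lt_in by [].
have e : Ordinal lt_in = lift ord_max (Ordinal lt_in) :> nat.
  by rewrite lift_max.
by rewrite [in LHS]e !nth_one_line lift_perm_lift.
Qed.

(** Appending the value [j] pushes the old values at or above [j] up by one, which keeps their
    relative order. So only the last comparison is new, and it is a descent exactly when the old
    last value was pushed up. *)
Lemma Des_lift_perm n (j : 'I_n.+2) (s : 'S_n.+1) (w : infword) :
  (Des (lift_perm ord_max j s) == wprefix w n.+1) =
  (Des s == wprefix w n) && ((j <= s ord_max) == w n).
Proof.
have lastE : nth 0 (one_line (lift_perm ord_max j s)) n.+1 = j.
  by have := nth_one_line (lift_perm ord_max j s) ord_max; rewrite lift_perm_id.
have lastsE : nth 0 (one_line s) n = s ord_max by rewrite (nth_one_line s ord_max).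
have bump_lt a b : (bump j a < bump j b) = (a < b) by rewrite /bump; lia.
have last_lt : (nth 0 (one_line (lift_perm ord_max j s)) n.+1
   < nth 0 (one_line (lift_perm ord_max j s)) n) = (j <= s ord_max).
  by rewrite lastE nth_lift_perm // lastsE /bump; lia.
apply/Des_eqP/andP => [H|[/Des_eqP H /eqP eqw] i].
  split; last by rewrite -last_lt H.
  apply/Des_eqP => i lt_in; rewrite -H; last by lia.
  by rewrite !nth_lift_perm ?bump_lt //; lia.
rewrite ltnS leq_eqVlt => /orP[/eqP[->]|lt_in]; first by rewrite last_lt.
by rewrite !nth_lift_perm ?bump_lt ?H //; lia.
Qed.

(** Delete the last entry and classify the remaining permutations by their own last value. *)
Lemma dcountS n w (j : nat) : j < n.+2 ->
  dcount n.+1 w j = \sum_(i < n.+1 | (j <= i) == w n) dcount n w i.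
Proof.
move=> lt_jn; pose J := Ordinal lt_jn.
have -> : dcount n.+1 w j =
    #|[set s : 'S_n.+1 | (Des s == wprefix w n) && ((j <= s ord_max) == w n)]|.
  rewrite -(card_imset _ (@lift_perm_inj _ ord_max J)) /dcount; apply: eq_card => t.
  rewrite inE; apply/andP/imsetP => [[Dt /eqP tj]|[s]].
    have [|s ts] := @lift_perm_surj _ ord_max J t; first exact: val_inj.
    by exists s => //; rewrite inE -(Des_lift_perm J) -ts.
  by rewrite inE -(Des_lift_perm J) => ? ->; rewrite lift_perm_id.
rewrite -sum1_card (partition_big (fun s : 'S_n.+1 => s ord_max)
  (fun i : 'I_n.+1 => (j <= i) == w n)) /=; last by move=> s; rewrite inE => /andP[].
apply: eq_bigr => i iw; rewrite sum1_card /dcount; apply: eq_card => s.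
rewrite unfold_in /= !inE -andbA; case: (_ == wprefix w n) => //=.
by rewrite andbC -val_eqE /=; case: eqP => //= ->.
Qed.

Lemma dcountE n w j : j <= n -> dcount n w j = dlast w n j.
Proof.
elim: n j => [|n IHn] j le_jn.
  have -> : j = 0 by lia.
  rewrite /dcount (_ : [set _ | _] = [set 1%g : 'S_1]) ?cards1 //.
  apply/setP => s; rewrite !inE.
  rewrite (_ : s = 1%g) ?eqxx ?perm1 //; last by apply/permP => k; rewrite !ord1.
rewrite dcountS //= (eq_bigr (fun i : 'I__ => dlast w n i)); last first.
  by move=> i _; apply: IHn; rewrite -ltnS.
case: (w n).
  rewrite (eq_bigl (fun i : 'I__ => j <= i)) => [|i]; last by rewrite eqb_id.
  rewrite -(big_mkord (fun i => j <= i) (dlast w n)).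
  rewrite (big_cat_nat (n := j)) //= big_nat_cond big_pred0 ?add0n => [|i];
    last by lia.
  by rewrite big_nat_cond [RHS]big_nat_cond; apply: eq_bigl => i; lia.
rewrite (eq_bigl (fun i : 'I__ => i < j)) => [|i]; last by rewrite eqbF_neg ltnNge.
rewrite -(big_mkord (fun i => i < j) (dlast w n)).
rewrite (big_cat_nat (n := j)) //= addnC big_nat_cond big_pred0 ?add0n => [|i];
  last by lia.
by rewrite big_nat_cond [RHS]big_nat_cond; apply: eq_bigl => i; lia.
Qed.

Lemma d_dlast w n : d_ n.+1 w = \sum_(0 <= j < n.+1) dlast w n j.
Proof.
rewrite big_mkord /d_ -sum1_card (partition_big (fun s : 'S_n.+1 => s ord_max) xpredT) //=.
apply: eq_bigr => i _; rewrite -dcountE ?leq_ord // sum1_card; apply: eq_card => s.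
by rewrite unfold_in /= !inE.
Qed.

Lemma eq_d_ n (w w' : infword) :
  (forall i, i.+1 < n -> w i = w' i) -> d_ n w = d_ n w'.
Proof.
move=> eqw; rewrite /d_ (_ : wprefix w n.-1 = wprefix w' n.-1) //.
by apply/eq_in_map => i; rewrite mem_iota => /= lt_in; apply: eqw; lia.
Qed.

Lemma eq_dlast n (w w' : infword) :
  (forall i, i < n -> w i = w' i) -> dlast w n =1 dlast w' n.
Proof.
elim: n => [//|n IHn] eqw j /=; rewrite eqw //.
have IH := IHn (fun i lt_in => eqw i (ltnW lt_in)).
by case: (w' n); apply: eq_bigr => i _; apply: IH.
Qed.

Lemma leq_dlast_d_ w n j : j <= n.+1 -> dlast w n.+1 j <= d_ n.+1 w.
Proof.
move=> le_jn; rewrite d_dlast /= [X in _ <= X](big_cat_nat (n := j)) //=.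
by case: (w n); rewrite ?leq_addr ?leq_addl.
Qed.

(** The extreme last value, 0 for a descent and n+1 for an ascent, is compatible with every shorter
    permutation, so its term alone is [d_ n.+1 w]. *)
Lemma d_S_ge w n : d_ n.+1 w <= d_ n.+2 w.
Proof.
rewrite [X in _ <= X]d_dlast d_dlast; case wn: (w n).
  by rewrite [X in _ <= X]big_nat_recl //= wn leq_addr.
by rewrite [X in _ <= X]big_nat_recr //= wn leq_addl.
Qed.

Lemma d_S_le w n : d_ n.+2 w <= n.+2 * d_ n.+1 w.
Proof.
rewrite d_dlast -[X in _ <= X * _]subn0 -sum_nat_const_nat.
rewrite big_nat [X in _ <= X]big_nat; apply: leq_sum => j /andP[_ lt_jn].
exact: leq_dlast_d_.
Qed.

Lemma sum_bin_lower k j : \sum_(0 <= i < j) 'C(i, k) = 'C(j, k.+1).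
Proof.
elim: j => [|j IHj]; first by rewrite big_nil bin0n.
by rewrite big_nat_recr //= IHj binS.
Qed.

(** Along ascents [dlast] is an iterated partial sum, and each summation raises the lower index of
    the binomial by the hockey-stick identity. *)
Lemma dlast_run w n k j : (forall i, i <= k -> w (n + i) = false) ->
  j <= (n + k).+1 -> dlast w (n + k).+1 j <= d_ n.+1 w * 'C(j, k).
Proof.
elim: k j => [|k IHk] j wn le_jn.
  by rewrite bin0 muln1 addn0; apply: leq_dlast_d_; rewrite -[n]addn0.
rewrite addnS /= -[(n + k).+1]addnS wn // -sum_bin_lower big_distrr /=.
rewrite big_nat [X in _ <= X]big_nat; apply: leq_sum => i /andP[_ lt_ij].
rewrite addnS; apply: IHk; last by lia.
by move=> i' ?; apply: wn; lia.
Qed.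

(** The last k entries increase, so they are fixed by their set of values, while the first n+1
    entries contribute only their pattern. *)
Lemma d_run_le w n k : (forall i, i < k -> w (n + i) = false) ->
  d_ (n + k).+1 w <= d_ n.+1 w * 'C((n + k).+1, k).
Proof.
case: k => [|k] wn; first by rewrite addn0 bin0 muln1.
rewrite d_dlast -sum_bin_lower big_distrr /= !addnS.
rewrite big_nat [X in _ <= X]big_nat; apply: leq_sum => i /andP[_ lt_ij].
exact: dlast_run.
Qed.

Lemma d_gt0 w n : 0 < d_ n.+1 w.
Proof.
elim: n => [|n IHn]; last exact: leq_trans (d_S_ge w n).
by rewrite d_dlast big_nat1.
Qed.

End last_value.

(** * Bernstein-type sums and their derivatives *)

Section bernstein_sums.
Context {R : realType}.
Implicit Types (D : nat -> R) (n : nat).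

(** Divided powers: differentiation lowers the index with coefficient 1 for [Xdiv] and -1 for
    [Ydiv], with no numerical factor. *)
Definition Xdiv n : {poly R} := (n`!%:R)^-1 *: 'X^n.
Definition Ydiv n : {poly R} := (n`!%:R)^-1 *: (1 - 'X) ^+ n.

Lemma factS_inv n : (n.+1`!%:R)^-1 * n.+1%:R = (n`!%:R)^-1 :> R.
Proof. by rewrite factS natrM invfM mulrAC mulVf ?mul1r // pnatr_eq0. Qed.

Lemma deriv_Xdiv0 : (Xdiv 0)^`() = 0.
Proof. by rewrite /Xdiv derivZ expr0 derivC scaler0. Qed.

Lemma deriv_XdivS n : (Xdiv n.+1)^`() = Xdiv n.
Proof. by rewrite /Xdiv derivZ derivXn -[_ *+ n.+1]scaler_nat scalerA factS_inv. Qed.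

Lemma deriv_Ydiv0 : (Ydiv 0)^`() = 0.
Proof. by rewrite /Ydiv derivZ expr0 derivC scaler0. Qed.

Lemma deriv_YdivS n : (Ydiv n.+1)^`() = - Ydiv n.
Proof.
rewrite /Ydiv derivZ deriv_exp derivB derivC derivX sub0r /= mulN1r.
by rewrite mulNrn scalerN -[_ *+ n.+1]scaler_nat scalerA factS_inv.
Qed.

(** The j-th basis polynomial is the density of the last of n+1 independent uniform variables on the
    event that they are ordered like a fixed permutation with last value j. *)
Definition bsum D n : {poly R} :=
  \sum_(0 <= j < n.+1) D j *: (Xdiv j * Ydiv (n - j)).

(** By the product rule each basis polynomial of index n occurs twice, from two neighbouring terms
    with opposite signs. *)
Lemma deriv_bsum D n : (bsum D n.+1)^`() = bsum (fun j => D j.+1 - D j) n.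
Proof.
rewrite /bsum raddf_sum /=.
under eq_bigr do rewrite derivZ derivM scalerDr.
rewrite big_split /= big_nat_recl //= deriv_Xdiv0 mul0r scaler0 add0r.
rewrite [X in _ + X]big_nat_recr //= subnn deriv_Ydiv0 mulr0 scaler0 addr0.
rewrite -big_split /= big_nat [RHS]big_nat; apply: eq_bigr => j /andP[_ lt_jn].
by rewrite deriv_XdivS subSS subSn // deriv_YdivS mulrN scalerN -scalerBl.
Qed.

Lemma bsum_0 D n : (bsum D n).[0] = D 0%N / n`!%:R.
Proof.
rewrite /bsum horner_sum big_nat_recl //= big1 ?addr0; last first.
  by move=> j _; rewrite /Xdiv !hornerE /= expr0n /= !(mulr0, mul0r).
by rewrite /Xdiv /Ydiv !hornerE subn0 /= fact0 subr0 !expr1n invr1 ?(mulr1, mul1r).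
Qed.

Lemma bsum_1 D n : (bsum D n).[1] = D n / n`!%:R.
Proof.
rewrite /bsum horner_sum big_nat_recr //= big_nat big1 ?add0r; last first.
  move=> j /andP[_ lt_jn]; rewrite /Ydiv !hornerE subrr expr0n subn_eq0.
  by rewrite leqNgt lt_jn /= !mulr0.
rewrite /Xdiv /Ydiv subnn !hornerE /= expr1n fact0 invr1 !mulr1 //.
Qed.

Lemma bsum_ge0 D n x : (forall j, 0 <= D j) -> 0 <= x <= 1 -> 0 <= (bsum D n).[x].
Proof.
move=> D0 /andP[x0 x1]; rewrite /bsum horner_sum sumr_ge0 // => j _.
by rewrite /Xdiv /Ydiv !hornerE !mulr_ge0 ?invr_ge0 ?exprn_ge0 ?subr_ge0.
Qed.

End bernstein_sums.

(** * Integration of continuous functions over [0, 1] *)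

Section unit_integral.
Context {R : realType}.
Implicit Types f g F : R -> R.
Local Notation mu := (@lebesgue_measure R).

Definition unit_int f : R := \int[mu]_(x in `[0, 1]%classic) f x.

Lemma unit_integrable f : continuous f ->
  mu.-integrable `[0, 1]%classic (EFin \o f).
Proof.
move=> cf; apply: continuous_compact_integrable; first exact: segment_compact.
exact: continuous_subspaceT.
Qed.

Lemma unit_intD f g : continuous f -> continuous g ->
  unit_int (fun x => f x + g x) = unit_int f + unit_int g.
Proof. by move=> cf cg; rewrite /unit_int RintegralD //; exact: unit_integrable. Qed.

Lemma unit_intZ f c : continuous f ->
  unit_int (fun x => c * f x) = c * unit_int f.
Proof. by move=> cf; rewrite /unit_int RintegralZl //; exact: unit_integrable. Qed.

Lemma le_unit_int f g : continuous f -> continuous g ->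
  (forall x, 0 <= x <= 1 -> f x <= g x) -> unit_int f <= unit_int g.
Proof.
by move=> cf cg fg; apply: (le_Rintegral _ (unit_integrable cf) (unit_integrable cg)).
Qed.

Lemma unit_int_derive f F : continuous f ->
  (forall x : R, is_derive x 1 F (f x)) -> unit_int f = F 1 - F 0.
Proof.
move=> cf dF.
have cF x : {for x, continuous F}.
  apply/differentiable_continuous/derivable1_diffP.
  by have [] := dF x.
rewrite /unit_int /Rintegral (@continuous_FTC2 _ _ F) //.
- exact: continuous_subspaceT.
- split=> [x _| |]; first by have [] := dF x.
  + by apply: cvg_at_right_filter; exact: cF.
  + by apply: cvg_at_left_filter; exact: cF.
- by move=> x _; rewrite derive1E; have [_ ->] := dF x.
Qed.

End unit_integral.

(** * Densities and their trigonometric moments *)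

Section density.
Context {R : realType}.
Implicit Types (w : infword) (n : nat) (x : R).

(** The index is shifted: this is the density of the last of n+1 variables, for the pattern given by
    the first n letters. *)
Definition dens w n : {poly R} := bsum (fun j => (dlast w n j)%:R) n.

Definition prob n w : R := (d_ n w)%:R / n`!%:R.

Lemma dens_ge0 w n x : 0 <= x <= 1 -> 0 <= (dens w n).[x].
Proof. by apply: bsum_ge0. Qed.

Lemma deriv_dens w n :
  (dens w n.+1)^`() = if w n then - dens w n else dens w n.
Proof.
rewrite /dens deriv_bsum /bsum; case wn: (w n); rewrite -?sumrN.
  rewrite big_nat [RHS]big_nat; apply: eq_bigr => j /andP[_ lt_jn].
  rewrite -scaleNr /= wn (big_ltn lt_jn) natrD opprD addrC.
  by rewrite addrAC -addrA subrr addr0.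
apply: eq_bigr => j _; rewrite /= wn big_nat_recr //= natrD.
by rewrite addrC addKr.
Qed.

(** The last value cannot be the smallest after an ascent, nor the largest after a descent. These
    zeros remove one boundary term each in the integrations by parts. *)
Lemma dens_0 w n : w n = false -> (dens w n.+1).[0] = 0.
Proof. by move=> wn; rewrite bsum_0 /= wn big_geq // mul0r. Qed.

Lemma dens_1 w n : w n -> (dens w n.+1).[1] = 0.
Proof. by move=> wn; rewrite bsum_1 /= wn big_geq // mul0r. Qed.

Lemma unit_int_dens w n : unit_int (horner (dens w n)) = prob n.+1 w.
Proof.
(* A primitive: partial sums have the coefficients of [dens w n] as differences. It is the density
   that an appended ascent would give, and its value at 1 collects all of [d_ n.+1 w]. *)
pose F := bsum (fun j => (\sum_(0 <= i < j) dlast w n i)%:R : R) n.+1.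
have dF : F^`() = dens w n.
  rewrite deriv_bsum; apply: eq_bigr => j _; congr (_ *: _).
  by rewrite big_nat_recr //= natrD addrC addKr.
have -> : unit_int (horner (dens w n)) = F.[1] - F.[0].
  apply: unit_int_derive => [|x]; first exact: continuous_horner.
  by rewrite -dF; exact: is_derive_poly.
by rewrite bsum_0 big_geq // mul0r subr0 bsum_1 -d_dlast.
Qed.

(** The frequency pi/2 makes [s] vanish at 0 and [c] at 1, the endpoints where [dens_1] and
    [dens_0], respectively, give nothing. *)
Let h : R := pi / 2.
Let s x := sin (h * x).
Let c x := cos (h * x).

Let h_gt0 : 0 < h. Proof. by rewrite divr_gt0 ?pi_gt0. Qed.

Let dZ x : is_derive x 1 (fun y : R => h * y) h.
Proof.
apply: (@trigger_derive _ (h \*: id) x (h *: 1)); last by rewrite /GRing.scale /= mulr1.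
Qed.

Let ds x : is_derive x 1 s (h * c x).
Proof.
by rewrite mulrC; exact: (is_derive1_comp (is_derive_sin (h * x)) (dZ x)).
Qed.

Let dc x : is_derive x 1 c (- h * s x).
Proof.
have := is_derive1_comp (is_derive_cos (h * x)) (dZ x).
by rewrite mulNr mulrC mulNr.
Qed.

Let cts (f df : R -> R) : (forall x : R, is_derive x 1 f (df x)) -> continuous f.
Proof.
move=> dF x; apply/differentiable_continuous/derivable1_diffP.
by have [] := dF x.
Qed.

Let hx_itv x : 0 <= x <= 1 -> 0 <= h * x <= pi / 2.
Proof.
move=> /andP[x0 x1]; rewrite mulr_ge0 ?(ltW h_gt0) //=.
by rewrite -[leRHS]mulr1 ler_pM2l.
Qed.

Let s_ge0 x : 0 <= x <= 1 -> 0 <= s x <= 1.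
Proof.
move=> /hx_itv/andP[x0 x1]; rewrite sin_le1 andbT sin_ge0_pi // x0 /=.
by rewrite (le_trans x1) // ler_pdivrMr // ler_peMr ?pi_ge0 // ler1n.
Qed.

Let c_ge0 x : 0 <= x <= 1 -> 0 <= c x <= 1.
Proof.
move=> /hx_itv/andP[x0 x1]; rewrite cos_le1 andbT cos_ge0_pihalf // x1 andbT.
by rewrite (le_trans _ x0) // oppr_le0 (ltW h_gt0).
Qed.

Definition sin_moment w n : R := unit_int (fun x => (dens w n).[x] * s x).
Definition cos_moment w n : R := unit_int (fun x => (dens w n).[x] * c x).

Let cdens w n : continuous (horner (dens w n)).
Proof. exact: continuous_horner. Qed.

Let contM (f g : R -> R) : continuous f -> continuous g ->
  continuous (fun x => f x * g x).
Proof. by move=> cf cg x; apply: cvgM; [exact: cf|exact: cg]. Qed.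

Let cs : continuous s. Proof. exact: cts ds. Qed.
Let cc : continuous c. Proof. exact: cts dc. Qed.

Let contZ a (f : R -> R) : continuous f -> continuous (fun x => a * f x).
Proof. by move=> cf; apply: contM => //; exact: cst_continuous. Qed.

Let contD (f g : R -> R) : continuous f -> continuous g ->
  continuous (fun x => f x + g x).
Proof. by move=> cf cg x; apply: cvgD; [exact: cf|exact: cg]. Qed.

(** Integrate the derivative of [dens w n.+1] times [c]: the boundary term at 0 vanishes by
    [dens_0], the one at 1 because [c 1 = 0]. *)
Lemma sin_momentS w n : w n = false ->
  pi / 2 * sin_moment w n.+1 = cos_moment w n.
Proof.
move=> wn; apply/esym/eqP; rewrite -subr_eq0 -mulNr; apply/eqP.
have cdc := contM (@cdens w n) cc; have cds := contM (@cdens w n.+1) cs.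
rewrite -(unit_intZ _ cds) -(unit_intD cdc (contZ cds)).
transitivity ((dens w n.+1).[1] * c 1 - (dens w n.+1).[0] * c 0); last first.
  by rewrite (dens_0 wn) /c /h mulr1 cos_pihalf mulr0 mul0r subrr.
apply: (@unit_int_derive _ _ (fun x => (dens w n.+1).[x] * c x)).
  exact: (contD cdc (contZ cds)).
move=> x; have := is_deriveM (is_derive_poly (dens w n.+1) x) (dc x).
rewrite deriv_dens wn; move/trigger_derive; apply.
by rewrite /GRing.scale /= /h; ring.
Qed.

(** The mirror case uses [dens w n.+1] times [s], with [dens_1] at 1 and [s 0 = 0]. *)
Lemma cos_momentS w n : w n ->
  pi / 2 * cos_moment w n.+1 = sin_moment w n.
Proof.
move=> wn; apply/eqP; rewrite -subr_eq0 -mulN1r; apply/eqP.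
have cdc := contM (@cdens w n.+1) cc; have cds := contM (@cdens w n) cs.
rewrite -(unit_intZ _ cds) -(unit_intZ _ cdc).
rewrite -(unit_intD (contZ cdc) (contZ cds)).
transitivity ((dens w n.+1).[1] * s 1 - (dens w n.+1).[0] * s 0); last first.
  by rewrite (dens_1 wn) /s mulr0 sin0 mulr0 mul0r subrr.
apply: (@unit_int_derive _ _ (fun x => (dens w n.+1).[x] * s x)).
  exact: (contD (contZ cdc) (contZ cds)).
move=> x; have := is_deriveM (is_derive_poly (dens w n.+1) x) (ds x).
rewrite deriv_dens wn hornerN; move/trigger_derive; apply.
by rewrite /GRing.scale /= /h; ring.
Qed.

Lemma sin_moment_le w n : sin_moment w n <= prob n.+1 w.
Proof.
rewrite -unit_int_dens; apply: le_unit_int => [||x x01]; [exact: contM|exact: cdens|].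
by rewrite ler_piMr ?dens_ge0 //; case/andP: (s_ge0 x01).
Qed.

Lemma cos_moment_le w n : cos_moment w n <= prob n.+1 w.
Proof.
rewrite -unit_int_dens; apply: le_unit_int => [||x x01]; [exact: contM|exact: cdens|].
by rewrite ler_piMr ?dens_ge0 //; case/andP: (c_ge0 x01).
Qed.

(** On [0, 1] both [s] and [c] lie in [0, 1], so s + c >= s^2 + c^2 = 1. *)
Lemma prob_le_moments w n : prob n.+1 w <= sin_moment w n + cos_moment w n.
Proof.
rewrite -unit_int_dens -unit_intD; [|exact: contM..].
apply: le_unit_int => [||x x01]; [exact: cdens|by apply: contD; exact: contM|].
rewrite -mulrDr ler_peMr ?dens_ge0 // -(cos2Dsin2 (h * x)) addrC.
have [/andP[s0 s1] /andP[c0 c1]] := (s_ge0 x01, c_ge0 x01).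
by apply: lerD; rewrite expr2 ler_piMr.
Qed.

Lemma eq_dens w w' n : (forall i, (i < n)%N -> w i = w' i) ->
  dens w n = dens w' n.
Proof. by move=> eqw; apply: eq_bigr => j _; rewrite (eq_dlast eqw). Qed.

Let rhoK : 2 / pi * (pi / 2) = 1 :> R.
Proof. by rewrite mulrA divfK ?divff // gt_eqF ?pi_gt0. Qed.

(** An ascent turns the cosine moment into the sine moment and a descent turns it back, each with
    the factor 2/pi. *)
Lemma alternating_cos_moment w n k :
  (forall i, (i < k)%N -> w (n + i)%N = odd i) ->
  (if odd k then sin_moment w (n + k) else cos_moment w (n + k)) =
  (2 / pi) ^+ k * cos_moment w n.
Proof.
elim: k => [|k IHk] wn; first by rewrite addn0 expr0 mul1r.
have {}IHk := IHk (fun i lt_ik => wn i (ltnW lt_ik)).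
rewrite exprS -mulrA -{}IHk addnS /=.
have wk := wn k (leqnn _).
case: (odd k) wk => /= wk; [rewrite -(cos_momentS wk)|rewrite -(sin_momentS wk)];
  by rewrite mulrA rhoK mul1r.
Qed.

Lemma alternating_sin_moment w n k :
  (forall i, (i < k)%N -> w (n + i)%N = ~~ odd i) ->
  (if odd k then cos_moment w (n + k) else sin_moment w (n + k)) =
  (2 / pi) ^+ k * sin_moment w n.
Proof.
elim: k => [|k IHk] wn; first by rewrite addn0 expr0 mul1r.
have {}IHk := IHk (fun i lt_ik => wn i (ltnW lt_ik)).
rewrite exprS -mulrA -{}IHk addnS /=.
have wk := wn k (leqnn _).
case: (odd k) wk => /= wk; [rewrite -(sin_momentS wk)|rewrite -(cos_momentS wk)];
  by rewrite mulrA rhoK mul1r.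
Qed.

Definition splice w n (v : infword) : infword :=
  fun i => if (i < n)%N then w i else v (i - n)%N.

Lemma splice_lt w n v i : (i < n)%N -> splice w n v i = w i.
Proof. by rewrite /splice => ->. Qed.

Lemma splice_add w n v i : splice w n v (n + i) = v i.
Proof. by rewrite /splice ltnNge leq_addr /= addKn. Qed.

(** One of the two moments is at least half of [prob n.+1 w]. Alternate from the letter that
    transports that moment, and bound the probability below by the moment reached. *)
Lemma prob_up w n : exists v, forall k,
  prob n.+1 w * (2 / pi) ^+ k / 2 <= prob (n + k).+1 (splice w n v).
Proof.
have rho_ge0 : 0 <= 2 / pi :> R by rewrite divr_ge0 ?pi_ge0.
have eqdens v : dens (splice w n v) n = dens w n.
  by apply: eq_dens => i; exact: splice_lt.
have [ge_c|lt_c] := leP (prob n.+1 w / 2) (cos_moment w n).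
  exists odd => k; rewrite mulrAC; set w' := splice _ _ _.
  have : (if odd k then sin_moment w' (n + k) else cos_moment w' (n + k)) =
         (2 / pi) ^+ k * cos_moment w n.
    rewrite alternating_cos_moment => [|i _]; last exact: splice_add.
    by rewrite /cos_moment eqdens.
  move=> E; apply: (@le_trans _ _ ((2 / pi) ^+ k * cos_moment w n)).
    by rewrite mulrC ler_wpM2l ?exprn_ge0.
  by rewrite -E; case: ifP => _; [exact: sin_moment_le|exact: cos_moment_le].
exists (fun i => ~~ odd i) => k; rewrite mulrAC; set w' := splice _ _ _.
have : (if odd k then cos_moment w' (n + k) else sin_moment w' (n + k)) =
       (2 / pi) ^+ k * sin_moment w n.
  rewrite alternating_sin_moment => [|i _]; last exact: splice_add.
  by rewrite /sin_moment eqdens.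
move=> E; apply: (@le_trans _ _ ((2 / pi) ^+ k * sin_moment w n)).
  rewrite mulrC ler_wpM2l ?exprn_ge0 //.
  by have := prob_le_moments w n; lra.
by rewrite -E; case: ifP => _; [exact: cos_moment_le|exact: sin_moment_le].
Qed.

End density.

(** * Elementary inequalities for powers and roots *)

Section real_powers.
Context {R : realType}.
Implicit Types (x y p c : R) (n k : nat).

(** AM-GM for n copies of x and k copies of y. It turns a bound on a product of probabilities into a
    weighted mean bounding the root. *)
Lemma AGM2_pow x y n k : 0 <= x -> 0 <= y ->
  x ^+ n * y ^+ k <= ((n%:R * x + k%:R * y) / (n + k)%:R) ^+ (n + k).
Proof.
move=> x0 y0.
pose E (i : 'I_n + 'I_k) := if i is inl _ then x else y.
have [|+ _] := @leif_AGM R _ predT E; first by case.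
rewrite !big_sumType /= !prodr_const !sumr_const card_sum !card_ord.
by rewrite -[x *+ n]mulr_natl -[y *+ k]mulr_natl.
Qed.

Lemma bernoulli x n : 0 <= x -> 1 + n%:R * x <= (1 + x) ^+ n.
Proof.
move=> x0; elim: n => [|n IHn]; first by rewrite mul0r addr0 expr0.
rewrite exprS; apply: le_trans (ler_wpM2l _ IHn); last by rewrite addr_ge0.
have : 0 <= n%:R * x * x by rewrite !mulr_ge0.
by rewrite -natr1; nra.
Qed.

(** A crude Stirling bound. The induction needs (1 + 1/(n+1))^(n+1) <= 4, which is AM-GM for n+1
    copies of (n+2)/(n+1) and two copies of 1/2, whose mean is exactly 1. *)
Lemma pow_le_fact k : (k%:R / 4) ^+ k <= k`!%:R :> R.
Proof.
have pow4 n : ((n.+2)%:R : R) ^+ n.+1 <= 4 * (n.+1)%:R ^+ n.+1.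
  have n1 : 0 < n.+1%:R :> R by [].
  have mean1 : (n.+1%:R * (n.+2%:R / n.+1%:R) + 2%:R * 2^-1) / (n.+1 + 2)%:R = 1 :> R.
    rewrite [n.+1%:R * _]mulrC divfK ?gt_eqF // [2%:R * _]mulfV ?pnatr_eq0 //.
    by rewrite natr1 addn2 mulfV ?pnatr_eq0.
  have x0 : 0 <= n.+2%:R / n.+1%:R :> R by rewrite divr_ge0.
  have y0 : 0 <= 2^-1 :> R by rewrite invr_ge0.
  have := AGM2_pow n.+1 2 x0 y0.
  rewrite mean1 expr1n expr_div_n mulrAC ler_pdivrMr ?exprn_gt0 // mul1r.
  by lra.
elim: k => [|k IHk]; first by rewrite expr0 fact0.
rewrite exprS factS natrM.
case: k IHk => [|k] IHk; first by rewrite expr0 fact0 mulr1; lra.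
have -> : (k.+2%:R / 4) * (k.+2%:R / 4) ^+ k.+1 =
   k.+2%:R * (k.+2%:R ^+ k.+1 / 4 / 4 ^+ k.+1) :> R.
  by rewrite expr_div_n; ring.
rewrite ler_wpM2l //; apply: le_trans IHk; rewrite expr_div_n.
by rewrite ler_wpM2r ?invr_ge0 ?exprn_ge0 // ler_pdivrMr // mulrC pow4.
Qed.

Lemma root_le p c n : (0 < n)%N -> 0 <= p -> 0 <= c -> p <= c ^+ n ->
  p `^ n%:R^-1 <= c.
Proof.
move=> n0 p0 c0 pc; apply: le_trans (_ : (c ^+ n) `^ n%:R^-1 <= c).
  by rewrite ge0_ler_powR ?nnegrE ?invr_ge0 ?exprn_ge0.
by rewrite -powR_mulrn // -powRrM mulfV ?powRr1 // pnatr_eq0 -lt0n.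
Qed.

Lemma root_ge p c n : (0 < n)%N -> 0 <= p -> 0 <= c -> c ^+ n <= p ->
  c <= p `^ n%:R^-1.
Proof.
move=> n0 p0 c0 pc; apply: le_trans (_ : c <= (c ^+ n) `^ n%:R^-1) _.
  by rewrite -powR_mulrn // -powRrM mulfV ?powRr1 // pnatr_eq0 -lt0n.
by rewrite ge0_ler_powR ?nnegrE ?invr_ge0 ?exprn_ge0.
Qed.

Lemma rootK p n : (0 < n)%N -> 0 <= p -> (p `^ n%:R^-1) ^+ n = p.
Proof.
move=> n0 p0; rewrite -powR_mulrn ?powR_ge0 // -powRrM mulVf ?powRr1 //.
by rewrite pnatr_eq0 -lt0n.
Qed.

End real_powers.

(** * Variation of the roots *)

Section dratio.
Context {R : realType}.
Implicit Types (w : infword) (n k : nat).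
Local Notation p n w := (prob n w : R).
Local Notation a n w := (dratio_root R w n).

Lemma prob_ge0 w n : 0 <= p n w.
Proof. by rewrite divr_ge0. Qed.

Lemma prob_gt0 w n : 0 < p n.+1 w.
Proof. by rewrite divr_gt0 ?ltr0n ?d_gt0 ?fact_gt0. Qed.

Lemma probS_ge w n : p n.+1 w / n.+2%:R <= p n.+2 w.
Proof.
rewrite /prob -mulrA -invfM -natrM mulnC -factS.
by rewrite ler_wpM2r ?invr_ge0 // ler_nat d_S_ge.
Qed.

Lemma prob_run w n k : (forall i, (i < k)%N -> w (n + i)%N = false) ->
  p (n + k).+1 w <= p n.+1 w / k`!%:R.
Proof.
move=> /d_run_le le_d; rewrite /prob ler_pdivrMr ?ltr0n ?fact_gt0 //.
apply: le_trans (_ : (d_ n.+1 w * 'C((n + k).+1, k))%:R <= _).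
  by rewrite ler_nat.
rewrite -(@bin_fact (n + k).+1 k) ?leqW ?leq_addl // subSn ?leq_addl // addnK.
rewrite (natrM R (d_ _ _)) (natrM R 'C(_, _)) (natrM R k`!).
rewrite [leRHS](_ : _ = (d_ n.+1 w)%:R * ('C((n + k).+1, k))%:R) //.
have fact_neq0 m : m`!%:R != 0 :> R by rewrite pnatr_eq0 -lt0n fact_gt0.
move: (fact_neq0 k) (fact_neq0 n.+1).
move: (k`!%:R) (n.+1`!%:R) => x y x0 y0; field.
by rewrite x0 y0.
Qed.

Lemma probS_le w n : p n.+2 w <= p n.+1 w.
Proof.
rewrite /prob ler_pdivrMr ?ltr0n ?fact_gt0 // (factS n.+1) (natrM R n.+2).
rewrite mulrA mulrAC divfK ?pnatr_eq0 -?lt0n ?fact_gt0 //.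
by rewrite -natrM ler_nat mulnC d_S_le.
Qed.

Lemma prob_le1 w n : p n.+1 w <= 1.
Proof.
elim: n => [|n IHn]; last exact: le_trans (probS_le w n) IHn.
by rewrite /prob d_dlast big_nat1 /= divr1.
Qed.

Lemma dratio_ge0 w n : 0 <= a n w.
Proof. exact: powR_ge0. Qed.

Lemma dratio_gt0 w n : 0 < a n.+1 w.
Proof. by rewrite powR_gt0 // prob_gt0. Qed.

Lemma dratio_le1 w n : a n.+1 w <= 1.
Proof. by apply: root_le; rewrite ?expr1n ?prob_le1 ?prob_ge0. Qed.

Lemma dratio_pow w n : a n.+1 w ^+ n.+1 = p n.+1 w.
Proof. by apply: rootK => //; exact: prob_ge0. Qed.

Lemma eq_dratio w w' n : (forall i, (i.+1 < n)%N -> w i = w' i) -> a n w = a n w'.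
Proof. by move=> eqw; rewrite /dratio_root (eq_d_ eqw). Qed.

(* Dominates the three errors met below: 1/n and 4/n from AM-GM, and 2/sqrt(n+1)
   from (n+1)^(-1/(n+1)) >= 1 - 2/sqrt(n+1). *)
Definition slack n : R := 4 / Num.sqrt n%:R.

Lemma slack_ge_inv n : 4 / n.+1%:R <= slack n.+1.
Proof.
rewrite ler_wpM2l // lef_pV2 ?posrE ?sqrtr_gt0 ?ltr0n //.
rewrite -[leRHS]sqr_sqrtr // expr2 ler_peMr ?sqrtr_ge0 //.
by rewrite -[leLHS]sqrtr1 ler_sqrt // ler1n.
Qed.

Lemma slack_le n m : (n <= m)%N -> slack m.+1 <= slack n.+1.
Proof.
move=> le_nm; rewrite ler_wpM2l // lef_pV2 ?posrE ?sqrtr_gt0 ?ltr0n //.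
by rewrite ler_sqrt ?ltr0n // ler_nat.
Qed.

Lemma slack_gt0 n : 0 < slack n.+1.
Proof. by rewrite divr_gt0 ?sqrtr_gt0 ?ltr0n. Qed.

(** Probabilities do not increase, so AM-GM applies to n+1 copies of a_(n+1) and a single factor
    1. *)
Lemma dratioS_le w n : a n.+2 w <= a n.+1 w + slack n.+1.
Proof.
have H : a n.+2 w <= (n.+1%:R * a n.+1 w + 1%:R * 1) / (n.+1 + 1)%:R.
  apply: root_le; rewrite ?prob_ge0 ?divr_ge0 ?addr_ge0 ?mulr_ge0 ?dratio_ge0 //.
  rewrite -addn1; apply: le_trans (AGM2_pow _ _ _ _); rewrite ?dratio_ge0 //.
  by rewrite expr1n mulr1 dratio_pow addn1 probS_le.
apply: le_trans H (le_trans _ (lerD (lexx _) (slack_ge_inv n))).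
rewrite ler_pdivrMr ?ltr0n // natrD.
have := dratio_ge0 w n.+1; set b := a _ _ => b0.
have x0 : 0 <= 4 / n.+1%:R :> R by rewrite divr_ge0.
have xn : 4 / n.+1%:R * n.+1%:R = 4 :> R by rewrite divfK ?pnatr_eq0.
by move: n.+1%:R (4 / n.+1%:R) x0 xn => m x x0 xn; rewrite mulr1n; nra.
Qed.

Lemma dratioS_ge w n : a n.+1 w - slack n.+1 <= a n.+2 w.
Proof.
set s : R := Num.sqrt n.+2%:R.
have s0 : 0 < s by rewrite sqrtr_gt0.
have s2 : s ^+ 2 = n.+2%:R by rewrite sqr_sqrtr.
(* A lower bound for (n+2)^(-1/(n+2)): by Bernoulli (1 + 1/s)^(n+2) >= 1 + s >= s, and squaring
   gives n+2. *)
pose t := (1 + s^-1)^-1 ^+ 2.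
have q0 : 0 < (1 + s^-1)^-1 by rewrite invr_gt0 addr_gt0 ?invr_gt0.
have t0 : 0 <= t by rewrite exprn_ge0 ?ltW.
have H : a n.+1 w * t <= a n.+2 w.
  apply: root_ge => //.
    exact: mulr_ge0 (dratio_ge0 _ _) t0.
  apply: le_trans (probS_ge w n); rewrite exprMn.
  apply: ler_pM; [exact: exprn_ge0 (dratio_ge0 _ _)|exact: exprn_ge0| |].
    (* The exponent n+2 exceeds n+1 by one; the extra factor is at most 1. *)
    by rewrite exprSr dratio_pow ler_piMr ?prob_ge0 ?dratio_le1.
  rewrite /t -exprM mulnC exprM -s2 -exprVn.
  rewrite lerXn2r ?nnegrE ?exprn_ge0 ?(ltW q0) ?invr_ge0 ?(ltW s0) //.
  rewrite exprVn lef_pV2 ?posrE ?exprn_gt0 ?addr_gt0 ?invr_gt0 //.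
  apply: le_trans (bernoulli _ _); last by rewrite invr_ge0 ltW.
  by rewrite -s2 expr2 mulfK ?gt_eqF // lerDr.
apply: le_trans H.
have le_s : 2 / s <= slack n.+1.
  rewrite /slack ler_pdivlMr ?sqrtr_gt0 ?ltr0n // mulrAC ler_pdivrMr //.
  have : Num.sqrt n.+1%:R <= s by rewrite ler_sqrt ?ler_nat ?ltr0n.
  by have := s0; lra.
have t_ge : 1 - 2 / s <= t.
  have u0 : 0 < s^-1 by rewrite invr_gt0.
  rewrite /t exprVn -[leRHS]mul1r ler_pdivlMr ?exprn_gt0 ?addr_gt0 //.
  set u := s^-1 in u0 *; nra.
have := dratio_ge0 w n.+1; have := dratio_le1 w n; set b := a _ _ => b1 b0.
apply: le_trans (ler_wpM2l b0 t_ge).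
have := ler_wpM2l b0 le_s; have := slack_gt0 n.
rewrite mulrBr mulr1 => ? ?; nra.
Qed.

Lemma splice_dratio w n v : a n.+1 (splice w n v) = a n.+1 w.
Proof. by apply: eq_dratio => i lt_in; rewrite splice_lt. Qed.

Lemma dratio_down w n k :
  a (n + k).+1 (splice w n (fun=> false)) <=
  (n.+1%:R * a n.+1 w + 4) / (n + k).+1%:R.
Proof.
set w' := splice _ _ _; rewrite -(splice_dratio w n (fun=> false)) -/w'.
(* By [pow_le_fact], 1/k! <= y^k, so AM-GM applies with k copies of y, of total at most 4. For k = 0
   the convention 4/0 = 0 is harmless. *)
pose y : R := 4 / k%:R.
have y0 : 0 <= y by rewrite divr_ge0.
have yk : (k`!%:R)^-1 <= y ^+ k.
  rewrite /y; have [->|k0] := posnP k; first by rewrite expr0 fact0 invr1.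
  rewrite -[4 / _]invrK exprVn lef_pV2 ?posrE ?invf_div ?pow_le_fact ?ltr0n ?fact_gt0 //.
  by rewrite exprn_gt0 ?divr_gt0 ?ltr0n.
have le_y : k%:R * y <= 4.
  by have [->|k0] := posnP k; rewrite ?mul0r // mulrC divfK // pnatr_eq0 -lt0n.
have a0 := dratio_ge0 w' n.+1.
apply: le_trans (_ : (n.+1%:R * a n.+1 w' + k%:R * y) / (n.+1 + k)%:R <= _); last first.
  by rewrite addSn ler_wpM2r ?invr_ge0 // lerD2l.
apply: root_le => //; first by rewrite divr_ge0 ?addr_ge0 ?mulr_ge0.
rewrite -addSn; apply: le_trans (AGM2_pow _ _ a0 y0); rewrite dratio_pow.
apply: le_trans (_ : p n.+1 w' / k`!%:R <= _); last by rewrite ler_wpM2l ?prob_ge0.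
by rewrite addSn; apply: prob_run => i _; rewrite /w' splice_add.
Qed.

(** The new base is c divided by 1 + 1/(n+1), whose (n+1)-th power is at least 2 by Bernoulli. This
    absorbs the factor 1/2 of [prob_up]. *)
Lemma half_pow_le (c : R) n : 0 <= c ->
  0 <= c - c / n.+2%:R /\ (c - c / n.+2%:R) ^+ n.+1 <= c ^+ n.+1 / 2.
Proof.
move=> c0; pose t : R := n.+1%:R / n.+2%:R.
have m0 : 0 < n.+1%:R :> R by [].
have -> : c - c / n.+2%:R = c * t.
  rewrite /t -[n.+2%:R]natr1; move: n.+1%:R m0 => m m0; field.
  by rewrite gt_eqF // addr_gt0.
have t0 : 0 < t by rewrite divr_gt0.
split; first exact: mulr_ge0 c0 (ltW t0).
rewrite exprMn ler_wpM2l ?exprn_ge0 // -[t]invrK exprVn lef_pV2 ?posrE ?exprn_gt0 ?invr_gt0 //.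
have -> : t^-1 = 1 + n.+1%:R^-1.
  rewrite /t invf_div -[n.+2%:R]natr1; move: n.+1%:R m0 => m m0; field.
  by rewrite gt_eqF.
apply: le_trans (bernoulli _ _); last by rewrite invr_ge0.
by rewrite divff ?pnatr_eq0.
Qed.

Lemma rho_gt0 : 0 < 2 / pi :> R.
Proof. by rewrite divr_gt0 ?pi_gt0. Qed.

Lemma rho_le1 : 2 / pi <= 1 :> R.
Proof. by rewrite ler_pdivrMr ?pi_gt0 // mul1r pi_ge2. Qed.

Lemma dratio_up w n : exists v,
  (forall k, Num.min (a n.+1 w) (2 / pi) - slack n.+1 <=
             a (n + k).+1 (splice w n v)) /\
  (forall c, c < 2 / pi -> exists K, forall k, (K <= k)%N ->
             c <= a (n + k).+1 (splice w n v)).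
Proof.
have [v vP] := @prob_up R w n; exists v.
have rho0 := rho_gt0; have rho1 := rho_le1.
move: (2 / pi : R) rho0 rho1 vP => rho rho0 rho1 vP.
have a0 := dratio_gt0 w n; set b := a n.+1 w in a0 *.
split=> [k|c lt_c].
  set c := Num.min b rho.
  have c0 : 0 <= c by rewrite le_min !ltW.
  have c1 : c <= 1 by rewrite ge_min rho1 orbT.
  have [c'0 c'P] := half_pow_le (n + k) c0.
  apply: le_trans (_ : c - c / (n + k).+2%:R <= _).
    rewrite lerD2l lerN2; apply: le_trans (slack_ge_inv n).
    apply: ler_pM; rewrite ?invr_ge0 //; first by rewrite (le_trans c1) ?ler1n.
    by rewrite lef_pV2 ?posrE ?ltr0n // ler_nat; lia.
  apply: root_ge => //; apply: le_trans c'P _; apply: le_trans (vP k).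
  rewrite ler_wpM2r ?invr_ge0 // -addSn exprD -dratio_pow -/b.
  have [cb crho] : c <= b /\ c <= rho by rewrite !ge_min !lexx orbT.
  by apply: ler_pM; rewrite ?exprn_ge0 // lerXn2r ?nnegrE ?(ltW a0) ?(ltW rho0).
have [c0|c0] := leP c 0; first by exists 0%N => k _; apply: le_trans c0 (dratio_ge0 _ _).
pose z := c / rho.
have z0 : 0 < z by rewrite divr_gt0.
have z1 : `|z| < 1 by rewrite gtr0_norm // ltr_pdivrMr // mul1r.
(* The goal c^(n+k+1) <= b^(n+1) rho^k / 2 reads z^(n+k+1) <= q, and the powers of z tend to 0. *)
pose q := (b / rho) ^+ n.+1 / 2.
have q0 : 0 < q by apply: divr_gt0; [exact: exprn_gt0 (divr_gt0 a0 rho0)|].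
have /cvgrPdist_le/(_ _ q0)[K _ KP] := cvg_expr z1.
exists K => k le_Kk; apply: root_ge => //; first exact: ltW.
apply: le_trans (vP k).
have := KP (n + k).+1 (leq_trans le_Kk (leq_trans (leq_addl n k) (leqnSn _))).
rewrite /= sub0r normrN ger0_norm ?exprn_ge0 ?(ltW z0) // /z /q !expr_div_n.
rewrite ler_pdivrMr ?exprn_gt0 // => H; apply: le_trans H _.
rewrite -dratio_pow -/b -[in leLHS]addSn exprD le_eqVlt; apply/orP; left; apply/eqP.
by field; rewrite expf_neq0 ?gt_eqF.
Qed.

Lemma slack_small (e : R) : 0 < e -> exists K, forall n, (K <= n)%N -> slack n.+1 <= e.
Proof.
move=> e0; exists (Num.truncn ((4 / e) ^+ 2)) => n le_Kn.
rewrite /slack ler_pdivrMr ?sqrtr_gt0 // mulrC -ler_pdivrMr //.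
rewrite -[leLHS]gtr0_norm ?divr_gt0 // -sqrtr_sqr ler_sqrt //.
have /andP[_ /ltW] := truncn_itv (sqr_ge0 (4 / e)); move=> /le_trans; apply.
by rewrite ler_nat.
Qed.

End dratio.

(** * Limits inferior and superior by epsilons *)

Section limsup.
Context {R : realType}.
Implicit Types (u : nat -> R) (l : R).

Lemma limn_esup_eq u l :
  (forall e, 0 < e -> exists N, forall n, (N <= n)%N -> u n <= l + e) ->
  (forall e, 0 < e -> forall N, exists2 n, (N <= n)%N & l - e <= u n) ->
  limn_esup (fun n => (u n)%:E) = l%:E.
Proof.
move=> ub lb; apply/eqP; rewrite eq_le; apply/andP; split.
  apply/lee_addgt0Pr => e e0; have [N NP] := ub _ e0.
  apply: ge_ereal_inf.
  exists (ereal_sup ((fun n => (u n)%:E) @` [set n | (N <= n)%N]%classic)) => //.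
    by exists [set n | (N <= n)%N]%classic => //; exists N.
  apply: ge_ereal_sup => _ [n /= le_Nn <-].
  by rewrite -EFinD lee_fin NP.
apply: le_ereal_inf_tmp => _ [A [N _ NA] <-].
apply/lee_subgt0Pr => e e0; have [n le_Nn le_u] := lb _ e0 N.
apply: ereal_sup_ge; exists (u n)%:E; last by rewrite -EFinB lee_fin.
by exists n => //; exact: NA.
Qed.

Lemma limn_einf_eq u l :
  (forall e, 0 < e -> exists N, forall n, (N <= n)%N -> l - e <= u n) ->
  (forall e, 0 < e -> forall N, exists2 n, (N <= n)%N & u n <= l + e) ->
  limn_einf (fun n => (u n)%:E) = l%:E.
Proof.
move=> lb ub; rewrite /limn_einf.
have -> : limn_esup (\- (fun n => (u n)%:E))%E = (- l)%:E.
  apply: (@limn_esup_eq (fun n => - u n)) => e e0.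
    have [N NP] := lb _ e0; exists N => n le_Nn.
    by have := NP n le_Nn; lra.
  by move=> N; have [n le_Nn le_u] := ub _ e0 N; exists n => //; lra.
by rewrite EFinN oppeK.
Qed.

End limsup.

(** * Steering *)

Section steering.
Context {R : realType}.
Variables (L L' : R).
Hypotheses (L_ge0 : 0 <= L) (LL' : L <= L') (L'_le : L' <= 2 / pi).
Local Notation a n w := (dratio_root R w n).
Local Notation slack := (@slack R).

(** One oscillation: from index n up to a peak m near L', then down to m' near L, where the next one
    starts. The errors include the initial distance to L, which is arbitrary only for the first
    oscillation. *)
Definition phase_spec (w : infword) n (w' : infword) m m' :=
  [/\ (n < m <= m')%N, forall i, (i < n)%N -> w' i = w i,
      forall j, (n <= j <= m')%N ->
        L - (`|a n.+1 w - L| + slack n.+1 *+ 2) <= a j.+1 w' <=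
        L' + (`|a n.+1 w - L| + slack n.+1 *+ 2),
      L' - slack n.+1 <= a m.+1 w' &
      `|a m'.+1 w' - L| <= slack n.+1].

Lemma climb w n : exists w1 m,
  [/\ (n < m)%N, forall i, (i < n)%N -> w1 i = w i,
      forall j, (n <= j <= m)%N ->
        L - (`|a n.+1 w - L| + slack n.+1) <= a j.+1 w1 <=
        L' + (`|a n.+1 w - L| + slack n.+1) &
      L' - slack n.+1 <= a m.+1 w1].
Proof.
have [leLL' leL'rho] := (LL', L'_le).
set eps := `|_|; set eta := slack n.+1; have eta0 : 0 < eta := slack_gt0 n.
have eps0 : 0 <= eps by exact: normr_ge0.
have /andP[ge_an le_an] : L - eps <= a n.+1 w <= L + eps.
  by rewrite -ler_distl lexx.
have [v [v_ge v_cvg]] := @dratio_up R w n; set w1 := splice w n v in v_ge v_cvg.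
have an1 : a n.+1 w1 = a n.+1 w by exact: splice_dratio.
(* Lowering the target by eta puts it strictly below 2/pi, even when L' = 2/pi. The least such m
   gives the upper bound: earlier values after n stay below the target. *)
have ex_m : exists m, (n < m)%N && (L' - eta <= a m.+1 w1).
  have [|K KP] := v_cvg (L' - eta); first by rewrite ltrBlDr ltr_pwDr.
  exists (n + K.+1)%N; rewrite KP // andbT; lia.
case: (ex_minnP ex_m) => m /andP[lt_nm ge_am] min_m.
exists w1, m; split=> // [i|j /andP[le_nj le_jm]]; first exact: splice_lt.
have lt_L' i : (n <= i < m)%N -> a i.+1 w1 <= L' + eps.
  rewrite leq_eqVlt => /andP[/predU1P[<-|lt_ni] lt_im].
    by rewrite an1; apply: le_trans le_an _; rewrite lerD2r.
  have [le_ai|/ltW] := leP (L' - eta) (a i.+1 w1); last by lra.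
  by have := min_m i; rewrite lt_ni le_ai => /(_ isT); lia.
apply/andP; split.
  rewrite -(subnKC le_nj); apply: le_trans (v_ge _).
  have : L - eps <= Num.min (a n.+1 w) (2 / pi) by rewrite le_min ge_an /=; lra.
  rewrite -/eta; lra.
have [lt_jm|le_mj] := ltnP j m.
  by have := lt_L' j; rewrite le_nj lt_jm => /(_ isT); lra.
have -> : j = m by lia.
(* At the peak itself, one step from the preceding index overshoots by at most eta. *)
case: m lt_nm {ge_am min_m le_jm le_mj} lt_L' => // m le_nm lt_L'.
have := lt_L' m; rewrite ltnSn andbT => /(_ le_nm).
have := @dratioS_le R w1 m; have : slack m.+1 <= eta by exact: slack_le.
lra.
Qed.

Lemma phase w n : exists w' m m', phase_spec w n w' m m'.
Proof.
have leLL' := LL'.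
have [w1 [m [lt_nm eq_w1 bnd1 ge_am]]] := climb w n.
rewrite /phase_spec; set eps := `|_| in bnd1 *; set eta := slack n.+1 in bnd1 ge_am *.
have eta0 : 0 < eta := slack_gt0 n.
have eta_m i : (n <= i)%N -> slack i.+1 <= eta by exact: slack_le.
set w2 := splice w1 m (fun=> false).
have eq12 j : (j <= m)%N -> a j.+1 w2 = a j.+1 w1.
  by move=> le_jm; apply: eq_dratio => i lt_ij; apply: splice_lt; lia.
have down k : a (m + k).+1 w2 <= (m.+1%:R * a m.+1 w1 + 4) / (m + k).+1%:R.
  exact: dratio_down.
have am0 := dratio_ge0 (R := R) w1 m.+1.
have ex_m' : exists m', (m <= m')%N && (a m'.+1 w2 <= L + eta).
  (* After this many ascents the bound of [dratio_down] is at most eta. *)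
  pose K := Num.truncn ((m.+1%:R * a m.+1 w1 + 4) / eta).
  exists (m + K)%N; rewrite leq_addr /=; apply: le_trans (down K) _.
  apply: le_trans (_ : eta <= _); last by rewrite lerDr.
  rewrite ler_pdivrMr // [leRHS]mulrC -ler_pdivrMr //.
  have num0 : 0 <= (m.+1%:R * a m.+1 w1 + 4) / eta.
    by rewrite divr_ge0 ?(ltW eta0) // addr_ge0 // mulr_ge0.
  have /andP[_ /ltW/le_trans->] := truncn_itv num0 => //.
  by rewrite ler_nat -/K; lia.
case: (ex_minnP ex_m') => m' /andP[le_mm' le_am'] min_m'.
(* Either m' = m, where the value is at least L' - eta, or the preceding value exceeded L + eta and
   one step loses at most eta. *)
have am'_ge : L - eta <= a m'.+1 w2.
  move: le_mm'; rewrite leq_eqVlt => /predU1P[<-|lt_mm'].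
    by rewrite eq12 //; lra.
  case: m' lt_mm' {le_am'} min_m' => // m' le_mm' min_m'.
  have [le_a|/ltW lt_a] := leP (a m'.+1 w2) (L + eta).
    by have := min_m' m'; rewrite le_a andbT => /(_ le_mm'); lia.
  have : slack m'.+1 <= eta by apply: eta_m; lia.
  by have := @dratioS_ge R w2 m'; lra.
exists w2, m, m'; split=> //; first 1 last.
- by move=> i lt_in; rewrite -eq_w1 //; apply: splice_lt; lia.
- move=> j /andP[le_nj le_jm'].
  have [le_jm|lt_mj] := leqP j m.
    rewrite eq12 //; have := bnd1 j; rewrite le_nj le_jm => /(_ isT).
    by rewrite mulr2n; lra.
  apply/andP; split.
    have [eq_j|neq_j] := eqVneq j m'.
      have : 0 <= eps by exact: normr_ge0.
      by rewrite eq_j mulr2n; lra.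
    have [le_a|/ltW lt_a] := leP (a j.+1 w2) (L + eta).
      by have := min_m' j; rewrite le_a (ltnW lt_mj) => /(_ isT); lia.
    have : 0 <= eps by exact: normr_ge0.
    by rewrite mulr2n; lra.
  (* The descent rises at most 4/(m+1) above the peak, which accounts for the second eta. *)
  rewrite -(subnKC (ltnW lt_mj)); apply: le_trans (down _) _.
  have /andP[_ le_am] : L - (eps + eta) <= a m.+1 w1 <= L' + (eps + eta).
    by apply: bnd1; lia.
  apply: le_trans (_ : a m.+1 w1 + eta <= _); last by rewrite mulr2n; lra.
  apply: le_trans (_ : a m.+1 w1 + slack m.+1 <= _); last first.
    by rewrite lerD2l eta_m // ltnW.
  apply: le_trans (_ : a m.+1 w1 + 4 / m.+1%:R <= _); last first.
    by rewrite lerD2l slack_ge_inv.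
  apply: le_trans (_ : (m.+1%:R * a m.+1 w1 + 4) / m.+1%:R <= _).
    rewrite ler_wpM2l ?addr_ge0 ?mulr_ge0 //.
    by rewrite lef_pV2 ?posrE ?ltr0n // ler_nat; lia.
  by rewrite mulrDl mulrAC divff ?pnatr_eq0 // mul1r.
- by rewrite eq12.
- by rewrite ler_distl am'_ge.
- by rewrite lt_nm.
Qed.

Lemma steered_word : exists w : infword,
  limn_einf (fun n : nat => (a n w)%:E) = L%:E /\
  limn_esup (fun n : nat => (a n w)%:E) = L'%:E.
Proof.
have /choice [step stepP] : forall s : infword * nat, exists t : infword * nat * nat,
    phase_spec s.1 s.2 t.1.1 t.1.2 t.2.
  by case=> w n; have [w' [m [m' P]]] := phase w n; exists (w', m, m').
pose next s := ((step s).1.1, (step s).2).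
pose St k := iter k next (fun=> false, 0%N).
pose W k := (St k).1; pose N k := (St k).2; pose M k := (step (St k)).1.2.
have spec k : phase_spec (W k) (N k) (W k.+1) (M k) (N k.+1) by exact: stepP.
have ltN k : (N k < N k.+1)%N by case: (spec k) => /andP[lt_m le_m] _ _ _ _; exact: leq_trans le_m.
have leN k l : (k <= l)%N -> (N k <= N l)%N.
  elim: l => [|l IHl]; first by case: k.
  rewrite leq_eqVlt => /predU1P[->//|/IHl le_kl].
  exact: leq_trans le_kl (ltnW (ltN l)).
have geN k : (k <= N k)%N by elim: k => // k IHk; exact: leq_ltn_trans (ltN k).
have eqW k l i : (k <= l)%N -> (i < N k)%N -> W l i = W k i.
  move=> le_kl lt_i; elim: l le_kl => [|l IHl]; first by case: k lt_i.
  rewrite leq_eqVlt ltnS => /predU1P[->//|le_kl]; rewrite -IHl //.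
  have [_ eq_l _ _ _] := spec l; apply: eq_l.
  exact: leq_trans lt_i (leN _ _ le_kl).
(* The limit word: as k <= N k, letter i is final from stage i+1 on. *)
pose w i := W i.+1 i.
have wE k i : (i < N k)%N -> w i = W k i.
  move=> lt_i; rewrite /w -(eqW _ (maxn k i.+1) _ (leq_maxr _ _)) ?geN //.
  by rewrite (eqW _ _ _ (leq_maxl _ _)).
have aE k j : (j <= N k)%N -> a j.+1 w = a j.+1 (W k).
  by move=> le_j; apply: eq_dratio => i lt_ij; apply: wE; exact: leq_trans le_j.
have near_L k : `|a (N k.+1).+1 w - L| <= slack (N k).+1.
  by rewrite (aE k.+1) //; case: (spec k).
have near_L' k : L' - slack (N k).+1 <= a (M k).+1 w.
  by rewrite (aE k.+1); case: (spec k) => // /andP[].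
have block K j : (N K <= j)%N -> exists2 k, (K <= k)%N & (N k <= j <= N k.+1)%N.
  elim: j => [|j IHj] le_j.
    by exists K => //; rewrite le_j.
  move: le_j; rewrite leq_eqVlt => /predU1P[<-|/IHj[k le_Kk /andP[le_kj le_jk]]].
    by exists K => //; rewrite leqnn ltnW.
  move: le_jk; rewrite leq_eqVlt => /predU1P[eq_j|lt_j]; last by exists k => //; rewrite leqW.
  by exists k.+1; [exact: leqW|rewrite eq_j leqnSn /= ltN].
have bound (e : R) : 0 < e -> exists J, forall j, (J <= j)%N ->
    L - e <= a j w <= L' + e.
  (* The error in a phase is its initial distance to L plus two slacks. Starting from [K.+1], every
     phase follows another one, so that distance is itself at most a slack, hence the three
     parts. *)
  move=> e0; have [|K KP] := @slack_small R (e / 3); first by rewrite divr_gt0.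
  exists (N K.+1).+1 => -[//|j]; rewrite ltnS => /block[[//|k] lt_Kk /andP[le_kj le_jk]].
  have [_ _ /(_ j)] := spec k.+1; rewrite le_kj le_jk => /(_ isT) + _ _.
  rewrite -(aE k.+2 j) // -(aE k.+1) // mulr2n.
  have le_Kk : (K <= k)%N by [].
  have := near_L k; have := KP (N k) (leq_trans le_Kk (geN k)).
  have := KP (N k.+1) (leq_trans (leqW le_Kk) (geN k.+1)).
  move: `|_| (slack _) (slack _) => x y z; lra.
exists w; split.
  apply: limn_einf_eq => e e0.
    by have [J JP] := bound _ e0; exists J => n /JP/andP[].
  move=> J; have [K KP] := slack_small e0.
  exists (N (maxn J K).+1).+1.
    by have := geN (maxn J K).+1; lia.
  have := near_L (maxn J K); have := KP (N (maxn J K)) (leq_trans (leq_maxr J K) (geN _)).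
  by rewrite ler_distl => ? /andP[_]; lra.
apply: limn_esup_eq => e e0.
  by have [J JP] := bound _ e0; exists J => n /JP/andP[].
move=> J; have [K KP] := slack_small e0.
exists (M (maxn J K)).+1.
  by have [/andP[+ _] _ _ _ _] := spec (maxn J K); have := geN (maxn J K); lia.
have := near_L' (maxn J K); have := KP (N (maxn J K)) (leq_trans (leq_maxr J K) (geN _)).
by lra.
Qed.

End steering.

Theorem theorem3p13 (R : realType) (L L' : R)
    (hL : L \in `[0, 2 / pi]) (hL' : L' \in `[0, 2 / pi]) (hLL' : L <= L') :
  exists w : infword,
    limn_einf (fun n : nat => (dratio_root R w n)%:E) = L%:E /\
    limn_esup (fun n : nat => (dratio_root R w n)%:E) = L'%:E.
Proof.
move: hL hL'; rewrite !in_itv /= => /andP[L_ge0 _] /andP[_ L'_le].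
exact: steered_word.
Qed.
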